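(* For every $n\ge1$ and every $M\in\mathbb N$ there is a constant $c_M$ such that the following holds. Let $p:\mathbb Z^n\to\mathbb C$ and, for $\xi,\theta\in\mathbb Z^n$, put $$r_M(\xi,\theta):=p(\xi+\theta)-\sum_{|\alpha|<M}\frac1{\alpha!}\,\theta^{(\alpha)}\,\triangle_\xi^\alpha p(\xi).$$ Then for all $\xi,\theta\in\mathbb Z^n$ and all $\omega\in\mathbb N^n$, $$\left|\triangle_\xi^\omega r_M(\xi,\theta)\right|\le c_M\max_{|\alpha|=M,\ \nu\in Q(\theta)}\left|\theta^{(\alpha)}\,\triangle_\xi^{\alpha+\omega}p(\xi+\nu)\right|,$$ where $Q(\theta):=\{\nu\in\mathbb Z^n:\ \min(0,\theta_j)\le\nu_j\le\max(0,\theta_j)\text{ for all }j=1,\dots,n\}$.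
   Context: $\mathbb N=\{0,1,2,\dots\}$ and $\alpha,\omega\in\mathbb N^n$ are multi-indices, $|\alpha|=\alpha_1+\dots+\alpha_n$, $\alpha!=\alpha_1!\cdots\alpha_n!$. With $v_j$ the $j$-th standard unit vector of $\mathbb Z^n$, $\triangle_{\xi_j}f(\xi):=f(\xi+v_j)-f(\xi)$ for $f:\mathbb Z^n\to\mathbb C$, and $\triangle_\xi^\alpha:=\triangle_{\xi_1}^{\alpha_1}\cdots\triangle_{\xi_n}^{\alpha_n}$; in $\triangle_\xi^\omega r_M(\xi,\theta)$ the differences act on $\xi$ with $\theta$ fixed. For $\theta\in\mathbb Z^n$, $\alpha\in\mathbb N^n$: $\theta^{(\alpha)}:=\prod_{j=1}^n\theta_j^{(\alpha_j)}$, where for $t\in\mathbb Z$, $t^{(0)}:=1$ and $t^{(k)}:=\prod_{i=0}^{k-1}(t-i)$ for $k>0$. *)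

(* Defs.v *)
From HB Require Import structures.
From mathcomp Require Export all_boot all_order all_algebra.
From mathcomp Require Export boolp classical_sets functions cardinality fsbigop.
From mathcomp Require Export reals.
From mathcomp Require Export complex.
From mathcomp Require Import finmap zify.

Set Implicit Arguments.
Unset Strict Implicit.
Unset Printing Implicit Defensive.

Import Order.TTheory GRing.Theory Num.Theory.

Local Open Scope classical_set_scope.
Local Open Scope ring_scope.
Local Open Scope complex_scope.

(* Multi-indices are added pointwise, by the ring-scope + on finite functions *)
Notation multiindex n := {ffun 'I_n -> nat}.

Definition mabs (n : nat) (a : multiindex n) : nat := (\sum_(j < n) a j)%N.

Definition mfact (n : nat) (a : multiindex n) : nat := (\prod_(j < n) (a j)`!)%N.

Definition fdiff (R : realType) (n : nat) (j : 'I_n) (f : 'rV[int]_n -> R[i]) :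
    'rV[int]_n -> R[i] :=
  fun xi => f (xi + delta_mx 0 j) - f xi.

Definition mdiff (R : realType) (n : nat) (a : multiindex n) :
    ('rV[int]_n -> R[i]) -> 'rV[int]_n -> R[i] :=
  \big[comp/id]_(j < n) iter (a j) (@fdiff R n j).

Definition falling (t : int) (k : nat) : int := \prod_(i < k) (t - i%:Z).

Definition mfalling (n : nat) (th : 'rV[int]_n) (a : multiindex n) : int :=
  \prod_(j < n) falling (th 0 j) (a j).

Definition rM (R : realType) (n M : nat) (p : 'rV[int]_n -> R[i])
    (xi th : 'rV[int]_n) : R[i] :=
  p (xi + th) -
    \sum_(a \in [set a : multiindex n | (mabs a < M)%N])
      ((mfact a)%:R)^-1 * (mfalling th a)%:~R * mdiff a p xi.

Definition Q (n : nat) (th : 'rV[int]_n) : set 'rV[int]_n :=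
  [set nu | forall j : 'I_n,
     Num.min 0 (th 0 j) <= nu 0 j <= Num.max 0 (th 0 j)].

(* The maximum of a nonnegative function over a finite set: on a nonempty
   finite set the default value 0 plays no role, see setmax_is_max below. *)
Definition setmax (R : realType) (T : choiceType) (A : set T) (F : T -> R) : R :=
  \big[Num.max/0]_(x <- fset_set A) F x.

Lemma finite_mabs_le (n m : nat) :
  finite_set [set a : multiindex n | (mabs a <= m)%N].
Proof.
pose g (f : {ffun 'I_n -> 'I_m.+1}) : multiindex n := [ffun j => val (f j)].
apply: (@sub_finite_set _ _ (g @` setT)).
  move=> a /= am; exists [ffun j => inord (a j)] => //.
  apply/ffunP => j; rewrite !ffunE /= inordK // ltnS.
  by apply: leq_trans am; rewrite /mabs (bigD1 j) //= leq_addr.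
exact/finite_image/finite_finset.
Qed.

Lemma finite_mabs_lt (n M : nat) :
  finite_set [set a : multiindex n | (mabs a < M)%N].
Proof.
by apply: sub_finite_set (finite_mabs_le n M) => a /= /ltnW.
Qed.

Lemma finite_Q (n : nat) (th : 'rV[int]_n) : finite_set (Q th).
Proof.
pose b := (\sum_(j < n) absz (th ord0 j))%N.
pose g (f : {ffun 'I_n -> 'I_(b + b).+1}) : 'rV[int]_n :=
  \row_j ((f j : nat)%:Z - b%:Z).
apply: (@sub_finite_set _ _ (g @` setT)); last exact/finite_image/finite_finset.
move=> nu /= nuQ; exists [ffun j => inord (absz (nu 0 j + b%:Z))] => //.
apply/rowP => j; rewrite !mxE ffunE.
have : (absz (th ord0 j) <= b)%N by rewrite /b (bigD1 j) //= leq_addr.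
have := nuQ j; move: (nu 0 j) (th 0 j) (b) => x t c xt tc.
by rewrite inordK; lia.
Qed.

Lemma Q_neq0 (n : nat) (th : 'rV[int]_n) : Q th !=set0.
Proof. by exists 0 => j; rewrite mxE ge_min le_max lexx. Qed.

Definition maxdom (n M : nat) (th : 'rV[int]_n) :
    set (multiindex n * 'rV[int]_n) :=
  [set z | mabs z.1 = M /\ Q th z.2].

Lemma finite_maxdom (n M : nat) (th : 'rV[int]_n) : finite_set (maxdom M th).
Proof.
apply: sub_finite_set (finite_setX (finite_mabs_le n M) (finite_Q th)).
by move=> z [/= <- Qz]; split => /=.
Qed.

Lemma maxdom_neq0 (n M : nat) (th : 'rV[int]_n) :
  (0 < n)%N -> maxdom M th !=set0.
Proof.
case: n th => // n th _; have [nu Qnu] := Q_neq0 th.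
exists ([ffun j => if j == ord0 then M else 0%N], nu); split => //=.
rewrite /mabs (bigD1 ord0) //= ffunE eqxx big1 ?addn0 // => j /negbTE j0.
by rewrite ffunE j0.
Qed.

Lemma setmax_is_max (R : realType) (T : choiceType) (A : set T) (F : T -> R) :
  finite_set A -> A !=set0 -> (forall x, A x -> 0 <= F x) ->
  (exists2 x, A x & F x = setmax A F) /\ (forall x, A x -> F x <= setmax A F).
Proof.
move=> finA A0 F0.
have ub x : A x -> F x <= setmax A F.
  by move=> Ax; apply: le_bigmax_seq => //; rewrite in_fset_set //; exact: mem_set.
split => //; case: A0 => x0 Ax0.
have : setmax A F = 0 \/ exists2 x, A x & F x = setmax A F.
  rewrite /setmax big_seq; elim/big_ind: _ => [|a b [->|[x Ax <-]] [->|[y Ay <-]]|x].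
  - by left.
  - by left; rewrite maxxx.
  - by right; exists y => //; rewrite max_r // F0.
  - by right; exists x => //; rewrite max_l // F0.
  - by right; case: (leP (F x) (F y)) => _; [exists y | exists x].
  - by rewrite in_fset_set // => /set_mem Ax; right; exists x.
case=> // max0; exists x0 => //; apply/eqP.
by rewrite eq_le ub //= max0 F0.
Qed.

(* Main.v *)
(* Differences commute with [p |-> r_M], so it suffices to treat [w = 0].
   In one variable, the remainders [R_N[f](t)] satisfy [R_N[f](0) = 0] for
   [N > 0] and [R_(N+1)[f](t+1) - R_(N+1)[f](t) = R_N[D f](t)]; by Pascal's rule
   for [|C(t,N)|] this yields [|R_N[f](t)| <= |C(t,N)| |D^N f(s)|] for some [s]
   between [0] and [t].  In several variables, one expands one coordinate at a
   time: if [th = th' + t e_j] with [th'_j = 0], then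
     r_M[p](x, th) = R_M[p](x + th', t)
                     + sum_(k < M) C(t,k) r_(M-k)[D_j^k p](x, th'),
   and each term is controlled by [th^(a) D^a p] with [|a| = M].  Treating [d]
   coordinates costs at most a factor [(M + 1)^d]. *)
Require Import Defs.
From mathcomp Require Import zify ring.
Import Order.TTheory GRing.Theory Num.Theory.
Local Open Scope classical_set_scope.
Local Open Scope ring_scope.
Local Open Scope complex_scope.

Local Notation normc := ComplexField.Normc.normc.

(** * The real-valued modulus on [R[i]] *)

Section ComplexModulus.
Variable R : realType.
Implicit Types x y : R[i].

Lemma normc_ge0 x : 0 <= normc x.
Proof. by case: x => a b; exact: Num.Theory.sqrtr_ge0. Qed.

Lemma ler_normcB x y : normc (x - y) <= normc x + normc y.
Proof. by rewrite -(normcN y); exact: le_normcD. Qed.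

Lemma normc_nat m : normc (m%:R : R[i]) = m%:R.
Proof.
by rewrite (@normcMn R 1 m) ComplexField.Normc.normc1.
Qed.

Lemma normc_int (z : int) : normc (z%:~R : R[i]) = `|z|%:~R.
Proof.
have normc_pos (m : nat) : normc (m%:~R : R[i]) = m%:R by exact: normc_nat.
case: (intP z) => [|m|m]; rewrite ?normc_pos //.
by rewrite rmorphN /= (@normcN R) normc_pos normrN.
Qed.

Lemma ler_normc_sum (I : Type) (r : seq I) (P : pred I) (F : I -> R[i]) :
  normc (\sum_(i <- r | P i) F i) <= \sum_(i <- r | P i) normc (F i).
Proof.
elim/big_rec2: _ => [|i y x _ le_xy]; first by rewrite ComplexField.Normc.normc0.
by apply: le_trans (le_normcD _ _) _; rewrite lerD2l.
Qed.

End ComplexModulus.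

(** * Falling factorials of integers and Pascal's rule for their absolute values *)

Section FallingFactorial.
Implicit Types (t : int) (k : nat).

Lemma falling0 t : falling t 0 = 1.
Proof. by rewrite /falling big_ord0. Qed.

Lemma fallingSr t k : falling t k.+1 = falling t k * (t - k%:Z).
Proof. by rewrite /falling big_ord_recr. Qed.

Lemma falling_shift t k : falling (t + 1) k.+1 = (t + 1) * falling t k.
Proof.
rewrite /falling big_ord_recl subr0; congr (_ * _).
by apply: eq_bigr => i _ /=; rewrite /bump /=; lia.
Qed.

Lemma falling_small t k : 0 <= t -> t < k%:Z -> falling t k = 0.
Proof.
case: t => // m _ lt_mk; have mk : (m < k)%N by lia.
by rewrite /falling (bigD1 (Ordinal mk)) //= subrr mul0r.
Qed.

Lemma falling_0l k : falling 0 k = (k == 0%N)%:R.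
Proof. by case: k => [|k]; [rewrite falling0 | rewrite falling_small]. Qed.

Lemma falling_pascal t k :
  falling (t + 1) k.+1 = falling t k.+1 + k.+1%:R * falling t k.
Proof. by rewrite falling_shift fallingSr -natr1 natz; ring. Qed.

(** Both terms of Pascal's rule have the same sign here: either [t < k] and [falling t k] vanishes,
    or [t + 1 = (t - k) + (k + 1)] has nonnegative summands. *)
Lemma abs_falling_pascal_ge0 t k : 0 <= t ->
  `|falling (t + 1) k.+1| = `|falling t k.+1| + k.+1%:R * `|falling t k|.
Proof.
move=> t0; rewrite falling_shift fallingSr !normrM.
have [lt_tk|le_kt] := ltP t k%:Z.
  by rewrite falling_small // normr0 !(mulr0, mul0r, addr0).
rewrite (ger0_norm (_ : 0 <= t + 1)) ?(ger0_norm (_ : 0 <= t - k%:Z)); by lia.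
Qed.

(** Left of [0] the growth is reversed: [t + 1] and [t - k] are nonpositive, so
    [|t - k| = |t + 1| + (k + 1)]. *)
Lemma abs_falling_pascal_lt0 t k : t < 0 ->
  `|falling t k.+1| = `|falling (t + 1) k.+1| + k.+1%:R * `|falling t k|.
Proof.
move=> t0; rewrite falling_shift fallingSr !normrM.
rewrite (ler0_norm (_ : t + 1 <= 0)) ?(ler0_norm (_ : t - k%:Z <= 0)); by lia.
Qed.

End FallingFactorial.

(** * Binomial coefficients with an integer upper argument *)

Section GeneralizedBinomial.
Variable R : realType.

Definition gbin (t : int) (k : nat) : R[i] := (k`!%:R)^-1 * (falling t k)%:~R.

Lemma gbin0 t : gbin t 0 = 1.
Proof. by rewrite /gbin falling0 invr1 mul1r. Qed.

Lemma normc_gbin t k : normc (gbin t k) = k`!%:R^-1 * `|falling t k|%:~R.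
Proof.
by rewrite /gbin ComplexField.Normc.normcM ComplexField.Normc.normcV normc_nat
  normc_int.
Qed.

Lemma natr_fact_neq0 (K : numFieldType) k : k`!%:R != 0 :> K.
Proof. by rewrite pnatr_eq0 -lt0n fact_gt0. Qed.

Lemma factS_invM (K : numFieldType) k (z : K) :
  k.+1`!%:R^-1 * (k.+1%:R * z) = k`!%:R^-1 * z.
Proof.
by rewrite factS natrM; field; rewrite natr_fact_neq0 nat1r pnatr_eq0.
Qed.

Lemma gbin_pascal t k : gbin (t + 1) k.+1 = gbin t k.+1 + gbin t k.
Proof.
rewrite /gbin falling_pascal intrD intrM mulrDr; congr (_ + _).
by rewrite rmorph_nat factS_invM.
Qed.

Lemma normc_gbin_pascal_ge0 t k : 0 <= t ->
  normc (gbin (t + 1) k.+1) = normc (gbin t k.+1) + normc (gbin t k).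
Proof.
move=> t0; rewrite !normc_gbin abs_falling_pascal_ge0 // intrD intrM.
by rewrite mulrDr rmorph_nat factS_invM.
Qed.

Lemma normc_gbin_pascal_lt0 t k : t < 0 ->
  normc (gbin t k.+1) = normc (gbin (t + 1) k.+1) + normc (gbin t k).
Proof.
move=> t0; rewrite !normc_gbin abs_falling_pascal_lt0 // intrD intrM.
by rewrite mulrDr rmorph_nat factS_invM.
Qed.

End GeneralizedBinomial.

(** * One-variable remainders and the calculus of iterated differences *)

Section Differences.
Variables (R : realType) (n : nat).
Implicit Types (f p : 'rV[int]_n -> R[i]) (i j : 'I_n) (a w : multiindex n).
Implicit Types (x th : 'rV[int]_n).

Definition taylor_rem j (N : nat) f x (t : int) : R[i] :=
  f (x + t *: delta_mx 0 j) - \sum_(k < N) gbin R t k * iter k (fdiff j) f x.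

(** The terms with [k = 0] cancel, and Pascal's rule turns the differences of the other coefficients
    into the coefficients for [fdiff j f]. *)
Lemma taylor_remS j N f x t :
  taylor_rem j N.+1 f x (t + 1) - taylor_rem j N.+1 f x t =
  taylor_rem j N (fdiff j f) x t.
Proof.
rewrite /taylor_rem /fdiff scalerDl scale1r addrA !big_ord_recl /= !gbin0.
rewrite -(_ : \sum_(k < N) gbin R (t + 1) k.+1 * iter k.+1 (fdiff j) f x -
    \sum_(k < N) gbin R t k.+1 * iter k.+1 (fdiff j) f x =
    \sum_(k < N) gbin R t k * iter k (fdiff j) (fdiff j f) x) /bump /=.
  ring.
rewrite -sumrB; apply: eq_bigr => k _.
by rewrite -mulrBl gbin_pascal addrC addKr -iterSr.
Qed.

Lemma taylor_rem0 j N f x : taylor_rem j N.+1 f x 0 = 0.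
Proof.
rewrite /taylor_rem scale0r addr0 big_ord_recl gbin0 mul1r big1 ?addr0 ?subrr //.
by move=> k _; rewrite /gbin falling_0l mulr0 mul0r.
Qed.

(** Induction on [N], then a walk from [0] to [t] by unit steps. At each step the weights of the two
    available bounds add up exactly to the new weight, so no constant is lost. *)
Lemma taylor_rem_bound j N f x t :
  exists2 s : int, Num.min 0 t <= s <= Num.max 0 t &
    normc (taylor_rem j N f x t) <=
    normc (gbin R t N) * normc (iter N (fdiff j) f (x + s *: delta_mx 0 j)).
Proof.
elim: N f t => [|N IHN] f t.
  exists t; first by rewrite ge_min le_max !lexx !orbT.
  rewrite /taylor_rem big_ord0 subr0 gbin0.
  by rewrite ComplexField.Normc.normc1 mul1r.
pose bnd u s := normc (gbin R u N.+1) *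
  normc (iter N.+1 (fdiff j) f (x + s *: delta_mx 0 j)).
(* One unit step from [u] to [v], away from [0]. Pascal's rule is anchored at the left end of the
   step, [Num.min u v], which covers both directions at once. *)
have bnd_combine u v s s' :
    normc (gbin R v N.+1) = normc (gbin R u N.+1) + normc (gbin R (Num.min u v) N) ->
    normc (taylor_rem j N.+1 f x v) <=
      normc (taylor_rem j N.+1 f x u) +
      normc (taylor_rem j N (fdiff j f) x (Num.min u v)) ->
    normc (taylor_rem j N.+1 f x u) <= bnd u s ->
    normc (taylor_rem j N (fdiff j f) x (Num.min u v)) <=
      normc (gbin R (Num.min u v) N) *
      normc (iter N (fdiff j) (fdiff j f) (x + s' *: delta_mx 0 j)) ->
    exists2 s'', s'' \in [:: s; s'] & normc (taylor_rem j N.+1 f x v) <= bnd v s''.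
  move=> gv tv lu; rewrite -iterSr => lm.
  (* Of the two candidate points, the one where the difference gives the larger bound. *)
  exists (if bnd v s' <= bnd v s then s else s').
    by case: ifP => _; rewrite !inE eqxx ?orbT.
  have -> : bnd v (if bnd v s' <= bnd v s then s else s') =
      Num.max (bnd v s) (bnd v s') by case: leP.
  apply: le_trans tv _.
  apply: le_trans (lerD lu lm) _.
  rewrite /bnd gv -maxr_pMr ?addr_ge0 ?normc_ge0 // mulrDl.
  by apply: lerD; apply: ler_wpM2l; rewrite ?normc_ge0 // le_max lexx ?orbT.
have pos (m : nat) : exists2 s : int, 0 <= s <= m%:Z &
    normc (taylor_rem j N.+1 f x m%:Z) <= bnd m%:Z s.
  elim: m => [|m [s sm lem]].
    exists 0; rewrite ?lexx // taylor_rem0 ComplexField.Normc.normc0.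
    by rewrite mulr_ge0 ?normc_ge0.
  have [s' sm' lem'] := IHN (fdiff j f) m%:Z.
  have mm : Num.min m%:Z m.+1%:Z = m%:Z by lia.
  have m1 : m.+1%:Z = m%:Z + 1 by lia.
  have [||||s'' sin le''] := bnd_combine m%:Z m.+1%:Z s s'; rewrite ?mm //.
  - by rewrite m1 normc_gbin_pascal_ge0.
  - by rewrite -taylor_remS m1 -{1}(subrK (taylor_rem j N.+1 f x m%:Z)
      (taylor_rem j N.+1 f x (m%:Z + 1))) addrC le_normcD.
  by exists s'' => //; move: sin; rewrite !inE => /orP[] /eqP->; lia.
have neg (m : nat) : exists2 s : int, - m%:Z <= s <= 0 &
    normc (taylor_rem j N.+1 f x (- m%:Z)) <= bnd (- m%:Z) s.
  elim: m => [|m [s sm lem]].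
    exists 0; rewrite ?lexx // oppr0 taylor_rem0 ComplexField.Normc.normc0.
    by rewrite mulr_ge0 ?normc_ge0.
  have [s' sm' lem'] := IHN (fdiff j f) (- m.+1%:Z).
  have mm : Num.min (- m%:Z) (- m.+1%:Z) = - m.+1%:Z by lia.
  have m1 : - m%:Z = - m.+1%:Z + 1 by lia.
  have [||||s'' sin le''] := bnd_combine (- m%:Z) (- m.+1%:Z) s s'; rewrite ?mm //.
  - by rewrite m1 normc_gbin_pascal_lt0.
  - by rewrite -taylor_remS -m1 -{1}(subKr (taylor_rem j N.+1 f x (- m%:Z))
      (taylor_rem j N.+1 f x (- m.+1%:Z))) ler_normcB.
  by exists s'' => //; move: sin; rewrite !inE => /orP[] /eqP->; lia.
have [t0|t0] := leP 0 t.
  have [s sb le_s] := pos `|t|%N; move: sb le_s; rewrite gez0_abs // => sb le_s.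
  by exists s.
have [s sb le_s] := neg `|t|%N; move: sb le_s; rewrite ltz0_abs // opprK => sb le_s.
by exists s.
Qed.

Lemma fdiffC i j f : fdiff i (fdiff j f) = fdiff j (fdiff i f).
Proof.
by apply/funext => x; rewrite /fdiff (addrAC x (delta_mx 0 j)); ring.
Qed.

Lemma iter_fdiffC (G : ('rV[int]_n -> R[i]) -> 'rV[int]_n -> R[i]) i k f :
  (forall g, G (fdiff i g) = fdiff i (G g)) ->
  G (iter k (fdiff i) f) = iter k (fdiff i) (G f).
Proof. by move=> GC; elim: k f => //= k IHk f; rewrite GC IHk. Qed.

(** An arbitrary list of directions instead of the fixed enumeration allows induction on the
    composition. *)
Definition mdiff_seq (r : seq 'I_n) a : ('rV[int]_n -> R[i]) -> 'rV[int]_n -> R[i] :=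
  \big[comp/id]_(j <- r) iter (a j) (fdiff j).

Lemma mdiff_seq_cons i r a f :
  mdiff_seq (i :: r) a f = iter (a i) (fdiff i) (mdiff_seq r a f).
Proof. by rewrite /mdiff_seq big_cons. Qed.

Lemma mdiff_seq_comm (G : ('rV[int]_n -> R[i]) -> 'rV[int]_n -> R[i]) r a f :
  (forall i g, G (fdiff i g) = fdiff i (G g)) ->
  G (mdiff_seq r a f) = mdiff_seq r a (G f).
Proof.
move=> GC; rewrite /mdiff_seq; elim: r f => [|i r IHr] f.
  by rewrite !big_nil.
by rewrite !big_cons /= -IHr (iter_fdiffC _ _ _ _ (GC i)).
Qed.

Lemma mdiff_comm (G : ('rV[int]_n -> R[i]) -> 'rV[int]_n -> R[i]) a f :
  (forall i g, G (fdiff i g) = fdiff i (G g)) -> G (mdiff a f) = mdiff a (G f).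
Proof. exact: mdiff_seq_comm. Qed.

Lemma mdiff_fdiff a j f : mdiff a (fdiff j f) = fdiff j (mdiff a f).
Proof. by rewrite (mdiff_comm (fdiff j)) // => i g; rewrite fdiffC. Qed.

Lemma mdiffD a w f : mdiff (a + w) f = mdiff a (mdiff w f).
Proof.
suff DD r g : mdiff_seq r (a + w) g = mdiff_seq r a (mdiff_seq r w g) by exact: DD.
elim: r g => [|i r IHr] g; first by rewrite /mdiff_seq !big_nil.
rewrite !mdiff_seq_cons ffunE iterD IHr.
congr (iter _ _ _); apply/esym/iter_fdiffC => h.
by rewrite (mdiff_seq_comm (fdiff i)) // => k h'; rewrite fdiffC.
Qed.

(* The multi-index [k e_j]. *)
Definition mono j (k : nat) : multiindex n := [ffun i => (k * (i == j))%N].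

Lemma mdiff_mono j k f : mdiff (mono j k) f = iter k (fdiff j) f.
Proof.
(* Only the factor at [j] differs from the identity, and [j] occurs exactly once in the
   enumeration. *)
rewrite /mdiff (_ : \big[comp/id]_(i < n) _ =
  iter (k * count_mem j (index_enum 'I_n)) (fdiff j)).
  by rewrite count_uniq_mem ?index_enum_uniq // mem_index_enum muln1.
elim: (index_enum 'I_n) => [|i r IHr]; first by rewrite big_nil muln0.
rewrite big_cons IHr ffunE; apply/funext => g /=; rewrite mulnDr iterD.
by case: eqVneq => [->|_] //; rewrite muln0.
Qed.

Lemma mdiff0 f : mdiff 0 f = f.
Proof.
rewrite /mdiff; elim: (index_enum 'I_n) => [|i r IHr]; first by rewrite big_nil.
by rewrite big_cons /= IHr ffunE.
Qed.

End Differences.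

(** * Multi-indices of bounded order and their splitting along one coordinate *)

Section MultiIndices.
Variable n : nat.
Implicit Types (j : 'I_n) (a b : multiindex n) (M k : nat).

Lemma mindexDE a b i : (a + b) i = (a i + b i)%N.
Proof. by rewrite ffunE. Qed.

Lemma mabsD a b : mabs (a + b) = (mabs a + mabs b)%N.
Proof. by rewrite /mabs -big_split; apply: eq_bigr => i _; rewrite ffunE. Qed.

Lemma mabs_mono j k : mabs (mono n j k) = k.
Proof.
rewrite /mabs (bigD1 j) //= ffunE eqxx muln1 big1 ?addn0 // => i /negbTE ij.
by rewrite ffunE ij muln0.
Qed.

Lemma leq_mabs a j : (a j <= mabs a)%N.
Proof. by rewrite /mabs (bigD1 j) //= leq_addr. Qed.

Lemma mabs0 : mabs (0 : multiindex n) = 0%N.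
Proof. by rewrite /mabs big1 // => i _; rewrite ffunE. Qed.

Definition mlt M : seq (multiindex n) :=
  finmap.enum_fset (fset_set [set a : multiindex n | (mabs a < M)%N]).

Lemma mem_mlt M a : (a \in mlt M) = (mabs a < M)%N.
Proof.
have -> : (a \in mlt M) = (a \in [set a : multiindex n | (mabs a < M)%N]).
  by rewrite -(in_fset_set (finite_mabs_lt n M)).
by apply/idP/idP => [/set_mem|/mem_set].
Qed.

Lemma mlt_uniq M : uniq (mlt M).
Proof. exact: finmap.fset_uniq. Qed.

(* Each [a] is written uniquely as [b + k e_j] with [b_j = 0]. *)
Lemma sum_mlt_split (V : nmodType) j M (F : multiindex n -> V) :
  \sum_(a <- mlt M) F a =
  \sum_(k < M) \sum_(a <- mlt (M - k) | a j == 0%N) F (a + mono n j k).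
Proof.
(* Group by the value of [a j], which is below [M] because [a j <= mabs a]. *)
transitivity (\sum_(k < M) \sum_(a <- mlt M | a j == k) F a).
  rewrite (exchange_big_dep predT) //= big_seq [RHS]big_seq.
  apply: eq_bigr => a; rewrite mem_mlt => aM.
  by rewrite (big_pred1 (Ordinal (leq_ltn_trans (leq_mabs a j) aM))).
apply: eq_bigr => k _.
rewrite -big_filter -[RHS]big_filter -(big_map (fun b => b + mono n j k) predT F).
apply: perm_big; apply: uniq_perm; rewrite ?filter_uniq ?mlt_uniq //.
  rewrite map_inj_uniq ?filter_uniq ?mlt_uniq // => a b /ffunP ab.
  by apply/ffunP => i; have := ab i; rewrite !mindexDE => /addIn.
move=> a; rewrite mem_filter mem_mlt; apply/andP/mapP => [[/eqP ak aM]|[b]].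
  (* The preimage of [a] under the shift by [k e_j]: erase coordinate [j]. *)
  pose b : multiindex n := [ffun i => if i == j then 0%N else a i].
  have aE : a = b + mono n j k.
    apply/ffunP => i; rewrite mindexDE !ffunE.
    by case: eqVneq => [->|_]; rewrite ?ak; lia.
  exists b => //; rewrite mem_filter mem_mlt ffunE eqxx /=.
  by move: aM; rewrite aE mabsD mabs_mono; lia.
rewrite mem_filter mem_mlt => /andP[/eqP bj bM] ->.
by rewrite mabsD mabs_mono mindexDE ffunE bj eqxx; split; [apply/eqP|]; lia.
Qed.

End MultiIndices.

(** * The multivariate remainder: commutation, splitting and bound *)

Section Remainder.
Variables (R : realType) (n : nat).
Implicit Types (p f : 'rV[int]_n -> R[i]) (j : 'I_n) (a b : multiindex n).
Implicit Types (x th nu : 'rV[int]_n) (M k : nat).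

Lemma taylor_coefE th a :
  ((mfact a)%:R)^-1 * (mfalling th a)%:~R = \prod_(i < n) gbin R (th 0 i) (a i).
Proof.
rewrite /mfact /mfalling natr_prod rmorph_prod /= -prodfV -big_split.
by [].
Qed.

Lemma rM_mltE M p x th :
  rM M p x th = p (x + th) -
    \sum_(a <- mlt n M) (\prod_(i < n) gbin R (th 0 i) (a i)) * mdiff a p x.
Proof.
rewrite /rM fsbig_finite; last exact: finite_mabs_lt.
by congr (_ - _); apply: eq_bigr => a _; rewrite taylor_coefE.
Qed.

(** The coefficients do not depend on [x], and differences commute. *)
Lemma rM_fdiff j M p th x :
  rM M (fdiff j p) x th = fdiff j (fun y => rM M p y th) x.
Proof.
rewrite [RHS]/fdiff !rM_mltE (eq_bigr (fun a =>
  (\prod_(i < n) gbin R (th 0 i) (a i)) * mdiff a p (x + delta_mx 0 j) -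
  (\prod_(i < n) gbin R (th 0 i) (a i)) * mdiff a p x)); last first.
  by move=> a _; rewrite -mulrBr mdiff_fdiff.
by rewrite sumrB /fdiff (addrAC x th); ring.
Qed.

Lemma mdiff_rM w M p th :
  mdiff w (fun x => rM M p x th) = fun x => rM M (mdiff w p) x th.
Proof.
apply/esym/(mdiff_comm R n (fun f x => rM M f x th)) => j g.
by apply/funext => x; rewrite rM_fdiff.
Qed.

(** Expand along [j] from [x + th], then expand each [iter k (fdiff j) p (x + th)] in the other
    coordinates. Since [C(0, a j) = 0] for [a j != 0], the inner sums keep only [a j = 0], which
    matches the splitting of the full sum over [a + k e_j]. *)
Lemma rM_split j M p x th (t : int) : th 0 j = 0 ->
  rM M p x (th + t *: delta_mx 0 j) =
  taylor_rem R n j M p (x + th) t +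
  \sum_(k < M) gbin R t k * rM (M - k) (iter k (fdiff j) p) x th.
Proof.
move=> thj; rewrite rM_mltE /taylor_rem -[RHS]addrA (addrA x); congr (_ + _).
rewrite (sum_mlt_split _ _ j) -!sumrN -big_split; apply: eq_bigr => k _ /=.
rewrite rM_mltE mulrBr addrA addNr add0r; congr (- _).
rewrite big_mkcond mulr_sumr; apply: eq_bigr => a _.
rewrite [X in X * mdiff a _ _](bigD1 j) //= thj.
case: ifPn => [/eqP aj|aj]; last first.
  rewrite /gbin falling_0l (negbTE aj).
  by rewrite mulr0 !(mul0r, mulr0).
rewrite aj gbin0 mul1r mulrA mdiffD mdiff_mono (bigD1 j) //=.
rewrite !mxE mindexDE ffunE thj aj.
rewrite !eqxx add0r add0n mulr1 muln1; congr (_ * _ * _).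
apply: eq_bigr => i /negbTE ij; rewrite !mxE mindexDE ffunE ij eqxx mulr0 addr0.
by rewrite muln0 addn0.
Qed.

Lemma mfalling_mono th t j a k : th 0 j = 0 -> a j = 0%N ->
  mfalling (th + t *: delta_mx 0 j) (a + mono n j k) =
  falling t k * mfalling th a.
Proof.
move=> thj aj; rewrite /mfalling (bigD1 j) //= [in RHS](bigD1 j) //=.
rewrite !mxE mindexDE ffunE thj aj !eqxx falling0 mul1r add0r mulr1 add0n muln1.
congr (_ * _); apply: eq_bigr => i /negbTE ij; rewrite !mxE mindexDE ffunE ij eqxx.
by rewrite mulr0 addr0 muln0 addn0.
Qed.

Lemma rM0 M p x : (0 < M)%N -> rM M p x 0 = 0.
Proof.
move=> M0; rewrite rM_mltE addr0 (bigD1_seq 0) ?mlt_uniq ?mem_mlt ?mabs0 //=.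
rewrite big1 => [|i _]; last by rewrite ffunE gbin0.
rewrite mdiff0 mul1r big1 ?addr0 ?subrr // => a a0.
have [i ai] : exists i, a i != 0%N.
  apply/existsP; apply: contraNT a0 => /existsPn a0.
  by apply/eqP/ffunP => i; rewrite ffunE; apply/eqP; rewrite -[_ == _]negbK a0.
by rewrite (bigD1 i) //= mxE /gbin falling_0l (negbTE ai) !(mulr0, mul0r).
Qed.

(* The coordinates of [th] of index at least [d] vanish: induction on [d] expands
   one coordinate at a time. *)
Lemma rM_bound d M p x th (m : R) :
  (forall i : 'I_n, (d <= i)%N -> th 0 i = 0) -> 0 <= m ->
  (forall a nu, mabs a = M -> Q th nu ->
     normc ((mfalling th a)%:~R * mdiff a p (x + nu)) <= m) ->
  normc (rM M p x th) <= (M.+1 ^ d)%:R * m.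
Proof.
elim: d M p x th m => [|d IHd] M p x th m thd m0 bnd.
  have {thd}th0 : th = 0 by apply/rowP => i; rewrite thd // mxE.
  rewrite expn0 mul1r th0 in bnd *; case: M bnd => [|M] bnd; last first.
    by rewrite rM0 // ComplexField.Normc.normc0.
  rewrite rM_mltE big_seq big1 ?subr0 => [|a]; last by rewrite mem_mlt.
  have Q0 : Q (0 : 'rV[int]_n) 0 by move=> i; rewrite !mxE minxx maxxx lexx.
  have := bnd 0 0 (mabs0 n) Q0; rewrite mdiff0 /mfalling big1 ?mul1r //.
  by move=> i _; rewrite ffunE falling0.
(* Once [d] reaches [n] there is no coordinate left to expand, and the constant only grows. *)
have [dn|nd] := ltnP d n; last first.
  apply: le_trans (IHd M p x th m _ m0 bnd) _ => [i di|].
    by have := ltn_ord i; lia.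
  by rewrite ler_wpM2r // ler_nat leq_pexp2l.
pose j := Ordinal dn; pose t := th 0 j; pose th' := th - t *: delta_mx 0 j.
have th'E i : th' 0 i = if i == j then 0 else th 0 i.
  rewrite !mxE eqxx /=; case: eqVneq => [->|_].
    by rewrite mulr1 subrr.
  by rewrite mulr0 subr0.
have th'j : th' 0 j = 0 by rewrite th'E eqxx.
have thE : th = th' + t *: delta_mx 0 j by rewrite subrK.
have th'd (i : 'I_n) : (d <= i)%N -> th' 0 i = 0.
  move=> di; rewrite th'E; case: eqVneq => // ij.
  by apply: thd; move: ij; rewrite -val_eqE /=; lia.
(* Here [th^(a + k e_j) = t^(k) th'^(a)], and [|C(t,k)| <= |t^(k)|] because [k! >= 1]. *)
have step a k nu : (mabs a + k)%N = M -> a j = 0%N -> Q th nu ->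
    normc (gbin R t k) * normc ((mfalling th' a)%:~R *
      mdiff a (iter k (fdiff j) p) (x + nu)) <= m.
  move=> ak aj Qnu; have := bnd (a + mono n j k) nu.
  rewrite mabsD mabs_mono mdiffD mdiff_mono => /(_ ak Qnu).
  rewrite [in mfalling th _]thE mfalling_mono //.
  rewrite intrM -mulrA ComplexField.Normc.normcM; apply: le_trans.
  rewrite ler_wpM2r ?normc_ge0 // normc_gbin normc_int ler_piMl ?ler0z //.
  by rewrite invf_le1 ?ler1n ?ltr0n fact_gt0.
rewrite thE rM_split //; apply: le_trans (le_normcD _ _) _.
have main : normc (taylor_rem R n j M p (x + th') t) <= m.
  have [s st /le_trans] := taylor_rem_bound R n j M p (x + th') t; apply.
  have Qs : Q th (th' + s *: delta_mx 0 j).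
    move=> i; rewrite mxE th'E !mxE eqxx /=; case: eqVneq => [->|_].
      by rewrite mulr1 add0r.
    by rewrite mulr0 addr0 ge_min le_max !lexx !orbT.
  have := step 0 M _ _ _ Qs; rewrite mabs0 ffunE mdiff0 addrA => /(_ erefl erefl).
  rewrite /mfalling big1 ?mul1r // => i _.
  by rewrite ffunE falling0.
(* The constant closes up because [1 + M (M+1)^d <= (M+1)^(d+1)]. *)
apply: (@le_trans _ _ (m + \sum_(k < M) (M.+1 ^ d)%:R * m)); last first.
  rewrite sumr_const card_ord -[X in m + X]mulr_natl mulrA -natrM.
  rewrite -{1}(mul1r m) -mulrDl.
  by rewrite ler_wpM2r // -[1]/(1%:R) -natrD ler_nat expnS mulSn leq_add2r expn_gt0.
apply: lerD => //; apply: le_trans (ler_normc_sum _ _ _ _ _) _.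
apply: ler_sum => k _; rewrite ComplexField.Normc.normcM.
have [->|g0] := eqVneq (gbin R t k) 0.
  by rewrite ComplexField.Normc.normc0 mul0r mulr_ge0.
have gt0 : 0 < normc (gbin R t k).
  rewrite lt_def normc_ge0 andbT.
  by apply: contra g0 => /eqP/ComplexField.Normc.eq0_normc->.
rewrite mulrC -ler_pdivlMr // -mulrA.
(* Dividing the bound by [|C(t,k)|] lets the outer factor cancel; this is why a zero coefficient was
   treated apart. *)
apply: le_trans (IHd _ _ _ _ (m / normc (gbin R t k)) th'd _ _) _.
- by rewrite divr_ge0 // ltW.
- move=> a nu aM Qnu; rewrite ler_pdivlMr // mulrC.
  have [aj|aj] := eqVneq (a j) 0%N; last first.
    rewrite /mfalling (bigD1 j) //= th'j falling_0l (negbTE aj).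
    by rewrite !mul0r ComplexField.Normc.normc0 mulr0.
  apply: step => //; first by have := ltn_ord k; lia.
  (* [Q th'] lies in [Q th]: at coordinate [j] it forces [nu] to be [0], which is admissible for
     every [t]. *)
  move=> i; have := Qnu i; rewrite th'E; case: eqVneq => // _.
  rewrite minxx maxxx => /le_anti <-.
  by rewrite ge_min le_max lexx.
- rewrite ler_wpM2r ?divr_ge0 ?(ltW gt0) // ler_nat.
  by case: (posnP d) => [->//|d_gt0]; rewrite leq_exp2r // ltnS leq_subr.
Qed.

End Remainder.

Theorem theorem2p7 (R : realType) (n M : nat) (hn : (0 < n)%N) :
  exists c : R,
    forall (p : 'rV[int]_n -> R[i]) (xi th : 'rV[int]_n) (w : multiindex n),
      ComplexField.Normc.normc (mdiff w (fun x => rM M p x th) xi)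
      <= c * setmax (maxdom M th)
               (fun z => ComplexField.Normc.normc
                  ((mfalling th z.1)%:~R * mdiff (z.1 + w) p (xi + z.2))).
Proof.
(* The constant of [rM_bound] for [d = n], where no coordinate is required to vanish, applied to
   [mdiff w p]. *)
exists (M.+1 ^ n)%:R => p xi th w; rewrite mdiff_rM.
set F := fun z : multiindex n * 'rV[int]_n => _.
have F0 z : maxdom M th z -> 0 <= F z by move=> _; exact: normc_ge0.
(* The maximum is attained since [0 < n] makes the index set nonempty; it is therefore nonnegative,
   as [rM_bound] requires of [m]. *)
have [[z zM zE] ub] := setmax_is_max (finite_maxdom M th) (maxdom_neq0 M th hn) F0.
apply: rM_bound => [i||a nu aM Qnu].
- by rewrite leqNgt ltn_ord.
- by rewrite -zE F0.
- by have := ub (a, nu) (conj aM Qnu); rewrite /F mdiffD.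
Qed.
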